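(* Let $(M,J,g)$ be a locally metallic Riemannian manifold with $J^2=pJ+qI$, $p,q\in\mathbb R$, and let $\nabla$ be the Levi-Civita connection of $g$. Then the generalized complex structure $\hat J_c:=\begin{pmatrix} J & -(I+J^2)\sharp_g\\ \flat_g & -J^*\end{pmatrix}$ on $TM\oplus T^*M$, i.e. $\hat J_c(X+\alpha)=JX-(I+J^2)\sharp_g\alpha+\flat_gX-J^*\alpha$, is $\nabla$-integrable.
   Context: A metallic Riemannian manifold $(M,J,g)$ is a smooth manifold with a $(1,1)$-tensor field $J$ satisfying $J^2=pJ+qI$ and a Riemannian metric $g$ with $g(JX,Y)=g(X,JY)$ for all vector fields $X,Y$. It is locally metallic if $\nabla J=0$ for the Levi-Civita connection $\nabla$ of $g$. $\flat_g:TM\to T^*M$, $\flat_g(X):=i_Xg$, and $\sharp_g$ is its inverse; $(J^*\alpha)(X):=\alpha(JX)$. $\hat J_c$ satisfies $\hat J_c^2=-I$ (this is what ''generalized complex structure'' means here). The bracket on $C^\infty(TM\oplus T^*M)$ is $[X+\alpha,Y+\beta]_\nabla:=[X,Y]+\nabla_X\beta-\nabla_Y\alpha$. An endomorphism $\hat J$ of $TM\oplus T^*M$ is $\nabla$-integrable if $N^\nabla_{\hat J}(\sigma,\tau):=[\hat J\sigma,\hat J\tau]_\nabla-\hat J[\hat J\sigma,\tau]_\nabla-\hat J[\sigma,\hat J\tau]_\nabla+\hat J^2[\sigma,\tau]_\nabla$ vanishes for all $\sigma,\tau\in C^\infty(TM\oplus T^*M)$. *)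

(* Defs.v *)
From HB Require Import structures.
From mathcomp Require Import all_boot all_order all_algebra.
From mathcomp Require Import ring.
From mathcomp Require Import all_classical all_reals all_analysis.

Set Implicit Arguments.
Unset Strict Implicit.
Unset Printing Implicit Defensive.

Import Order.TTheory GRing.Theory Num.Theory.
Import numFieldNormedType.Exports.

Local Open Scope classical_set_scope.
Local Open Scope ring_scope.

Section SmoothOn.
Context {R : realType} {n : nat}.
Local Notation V := 'rV[R]_n.
Implicit Types (U : set V) (W : normedModType R).

(* Since [U] is open wherever this is used, the values of [f] outside [U] are
   irrelevant. *)
Fixpoint Ck_on W (k : nat) U (f : V -> W) : Prop :=
  {in U, continuous f} /\
  if k is k'.+1 then
    (forall v x, U x -> derivable f x v) /\
    (forall v, Ck_on k' U (fun x => 'D_v f x))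
  else True.

Definition smooth_on W U (f : V -> W) : Prop := forall k, Ck_on k U f.

Lemma Ck_on_pred W k U (f : V -> W) : Ck_on k.+1 U f -> Ck_on k U f.
Proof.
elim: k f => [|k IH] f [cf [df Df]]; first by [].
split=> //; split=> // v; exact/IH/Df.
Qed.

Lemma eq_Ck_on W k U (f g : V -> W) :
  open U -> {in U, f =1 g} -> Ck_on k U f -> Ck_on k U g.
Proof.
move=> oU; have near_fg (f' g' : V -> W) x : {in U, f' =1 g'} -> U x ->
    {near x, f' =1 g'}.
  move=> fg Ux; near=> y; apply: fg; apply/mem_set.
  by near: y; exact: open_nbhs_nbhs.
have cont (f' g' : V -> W) : {in U, f' =1 g'} -> {in U, continuous f'} ->
    {in U, continuous g'}.
  move=> fg cf x xU; have Ux := set_mem xU.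
  rewrite /continuous_at -(fg x xU).
  apply: cvg_trans (cf x xU); exact: near_eq_cvg (near_fg _ _ _ fg Ux).
elim: k f g => [|k IH] f g fg [cf].
  by split=> //; exact: cont cf.
move=> [df Df]; split; first exact: cont cf.
split=> [v x Ux|v]; first exact: near_eq_derivable (near_fg _ _ _ fg Ux) (df v x Ux).
apply: IH (Df v) => x xU; apply: near_eq_derive.
exact: near_fg _ _ _ fg (set_mem xU).
Unshelve. all: by end_near. Qed.

Lemma Ck_on_cst W k U (c : W) : Ck_on k U (cst c : V -> W).
Proof.
elim: k c => [|k IH] c; first by split=> // x _; exact: cst_continuous.
split; first by move=> x _; exact: cst_continuous.
split=> [v x _|v]; first exact: derivable_cst.
have -> : (fun x : V => 'D_v (cst c) x) = cst (0 : W).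
  by apply/funext => x; rewrite derive_cst.
exact: IH.
Qed.

Lemma Ck_onD W k U (f g : V -> W) :
  open U -> Ck_on k U f -> Ck_on k U g -> Ck_on k U (f \+ g).
Proof.
move=> oU; elim: k f g => [|k IH] f g [cf rf] [cg rg].
  by split=> // x xU; apply: continuousD; [exact: cf|exact: cg].
split; first by move=> x xU; apply: continuousD; [exact: cf|exact: cg].
case: rf rg => [df Df] [dg Dg].
split=> [v x Ux|v]; first exact: derivableD (df v x Ux) (dg v x Ux).
apply: eq_Ck_on oU _ (IH _ _ (Df v) (Dg v)) => x /set_mem Ux /=.
by rewrite (deriveD (df v x Ux) (dg v x Ux)).
Qed.

Lemma Ck_onM k U (f g : V -> R) :
  open U -> Ck_on k U f -> Ck_on k U g -> Ck_on k U (f \* g).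
Proof.
move=> oU; elim: k f g => [|k IH] f g /[dup] Cf [cf rf] /[dup] Cg [cg rg].
  by split=> // x xU; apply: continuousM; [exact: cf|exact: cg].
split; first by move=> x xU; apply: continuousM; [exact: cf|exact: cg].
case: rf rg => [df Df] [dg Dg].
split=> [v x Ux|v]; first exact: derivableM (df v x Ux) (dg v x Ux).
apply: (@eq_Ck_on _ _ _ ((f \* (fun x => 'D_v g x)) \+
                         (g \* (fun x => 'D_v f x)))) => //.
- move=> x /set_mem Ux /=.
  by rewrite (deriveM (df v x Ux) (dg v x Ux)).
- apply: Ck_onD => //.
  + exact: IH (Ck_on_pred Cf) (Dg v).
  + exact: IH (Ck_on_pred Cg) (Df v).
Qed.

End SmoothOn.

(* A chart of dimension [n]: [chart_fun] is a homeomorphism from the open set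
   [chart_dom] onto the open set [chart_fun @` chart_dom], with inverse
   [chart_inv]; both maps are total, with junk values elsewhere. *)
Record chart (R : realType) (n : nat) (M : topologicalType) := Chart {
  chart_dom : set M;
  chart_fun : M -> 'rV[R]_n;
  chart_inv : 'rV[R]_n -> M;
  chart_dom_open : open chart_dom;
  chart_img_open : open (chart_fun @` chart_dom);
  chart_funK : {in chart_dom, cancel chart_fun chart_inv};
  chart_fun_continuous : {in chart_dom, continuous chart_fun};
  chart_inv_continuous : {in chart_fun @` chart_dom, continuous chart_inv} }.

Record smoothManifold (R : realType) (n : nat) := SmoothManifold {
  mfd_space :> topologicalType;
  mfd_hausdorff : hausdorff_space mfd_space;
  mfd_second_countable : @second_countable mfd_space;
  mfd_atlas : set (chart R n mfd_space);
  mfd_atlas_cover : forall x : mfd_space, exists2 c, mfd_atlas c & chart_dom c x;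
  mfd_atlas_smooth : forall c d, mfd_atlas c -> mfd_atlas d ->
    smooth_on (chart_fun c @` (chart_dom c `&` chart_dom d))
      (chart_fun d \o chart_inv c) }.

Section SmoothFunctions.
Context {R : realType} {n : nat}.
Implicit Type M : smoothManifold R n.

Definition smooth_fun M (f : M -> R) : Prop :=
  forall c, mfd_atlas c ->
    smooth_on (chart_fun c @` chart_dom c) (f \o chart_inv c).

Definition smooth_pred M : {pred M -> R} := [pred f | `[< smooth_fun f >]].

Record Cinf M := MkCinf { Cinf_fun :> M -> R; _ : Cinf_fun \in @smooth_pred M }.

Lemma smooth_subring M : subring_closed (@smooth_pred M).
Proof.
have cstP (a : R) : @smooth_fun M (cst a) by move=> c _ k; exact: Ck_on_cst.
have D f g : smooth_fun f -> smooth_fun g -> @smooth_fun M (f + g).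
  move=> sf sg c cA k; apply: Ck_onD; first exact: chart_img_open.
  - exact: sf.
  - exact: sg.
have Mul f g : smooth_fun f -> smooth_fun g -> @smooth_fun M (f * g).
  move=> sf sg c cA k; apply: Ck_onM; first exact: chart_img_open.
  - exact: sf.
  - exact: sg.
split=> [|f g /asboolP sf /asboolP sg|f g /asboolP sf /asboolP sg];
  apply/asboolP.
- exact: cstP.
- suff -> : f - g = f + cst (-1) * g by apply: D => //; exact: Mul.
  by apply/funext => x; rewrite !fctE mulN1r.
- exact: Mul.
Qed.

Lemma smooth_scale M (a : R) (f : M -> R) :
  f \in @smooth_pred M -> a *: f \in @smooth_pred M.
Proof.
move=> sf; have [_ _] := smooth_subring M; apply=> //.
by apply/asboolP => c _ k; exact: Ck_on_cst.
Qed.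

End SmoothFunctions.

Section CinfStructure.
Context (R : realType) (n : nat) (M : smoothManifold R n).

HB.instance Definition _ := [isSub for @Cinf_fun R n M].
HB.instance Definition _ := [Choice of Cinf M by <:].
HB.instance Definition _ :=
  GRing.SubChoice_isSubComPzRing.Build (M -> R) (@smooth_pred R n M) (Cinf M)
    (smooth_subring M).

Lemma smooth_subsemimod : subsemimod_closed (@smooth_pred R n M).
Proof.
split; last by move=> a f; exact: smooth_scale.
exact/GRing.zmod_closedD/GRing.subring_closedB/smooth_subring.
Qed.

HB.instance Definition _ :=
  GRing.SubZmodule_isSubLmodule.Build R (M -> R) (@smooth_pred R n M) (Cinf M)
    smooth_subsemimod.

End CinfStructure.

(* Vector fields are the [R]-derivations of the algebra of smooth functions,
   and the value of [X] at [x] is the tangent vector [fun f => X f x].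
   Tensor fields are accordingly [Cinf M]-multilinear maps between modules of
   sections; in particular 1-forms are [Cinf M]-linear forms on vector fields. *)
Section VectorFields.
Context {R : realType} {n : nat}.
Implicit Type M : smoothManifold R n.

Definition is_derivation M (X : Cinf M -> Cinf M) : Prop :=
  linear X /\ forall f h, X (f * h) = f * X h + h * X f.

Definition derivation_pred M : {pred Cinf M -> Cinf M} :=
  [pred X | `[< is_derivation X >]].

Record vfield M := MkVfield {
  vfield_fun :> Cinf M -> Cinf M;
  _ : vfield_fun \in @derivation_pred M }.

Lemma derivation_zmod M : zmod_closed (@derivation_pred M).
Proof.
split=> [|X Y /asboolP[lX dX] /asboolP[lY dY]]; apply/asboolP; split.
- by move=> a f h; rewrite /= scaler0 addr0.
- by move=> f h; rewrite /= !mulr0 addr0.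
- by move=> a f h; rewrite !fctE lX lY scalerBr addrACA opprD.
- by move=> f h; rewrite !fctE dX dY !mulrBr addrACA opprD.
Qed.

End VectorFields.

Section VectorFieldStructure.
Context (R : realType) (n : nat) (M : smoothManifold R n).
Implicit Types (f h : Cinf M) (X Y : vfield M).

HB.instance Definition _ := [isSub for @vfield_fun R n M].
HB.instance Definition _ := [Choice of vfield M by <:].
HB.instance Definition _ :=
  GRing.SubChoice_isSubZmodule.Build (Cinf M -> Cinf M)
    (@derivation_pred R n M) (vfield M) (derivation_zmod M).

Lemma vfieldP X : is_derivation X.
Proof. by case: X => X /= /asboolP. Qed.

Lemma vfield_ext X Y : (forall f, X f = Y f) -> X = Y.
Proof. by move=> XY; apply/val_inj/funext. Qed.

Lemma scale_derivation h X : (fun f => h * X f) \in @derivation_pred R n M.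
Proof.
apply/asboolP; split=> [a f1 f2|f1 f2].
  have [-> _] := vfieldP X; rewrite mulrDr; congr (_ + _).
  by apply/val_inj/funext => x; rewrite /= !fctE mulrCA.
have [_ ->] := vfieldP X.
by rewrite mulrDr mulrCA; congr (_ + _); rewrite mulrCA.
Qed.

Definition scale_vfield h X : vfield M := MkVfield (scale_derivation h X).

Fact scale_vfieldA f h X :
  scale_vfield f (scale_vfield h X) = scale_vfield (f * h) X.
Proof. by apply: vfield_ext => k; rewrite /= mulrA. Qed.

Fact scale_vfield1 : left_id 1 scale_vfield.
Proof. by move=> X; apply: vfield_ext => k; rewrite /= mul1r. Qed.

Fact scale_vfieldDr : right_distributive scale_vfield +%R.
Proof. by move=> h X Y; apply: vfield_ext => k; rewrite /= mulrDr. Qed.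

Fact scale_vfieldDl X : {morph scale_vfield^~ X : f h / f + h}.
Proof. by move=> f h; apply: vfield_ext => k; rewrite /= mulrDl. Qed.

HB.instance Definition _ := GRing.Zmodule_isLmodule.Build (Cinf M) (vfield M)
  scale_vfieldA scale_vfield1 scale_vfieldDr scale_vfieldDl.

Lemma lie_derivation X Y :
  (fun f => X (Y f) - Y (X f)) \in @derivation_pred R n M.
Proof.
have [lX dX] := vfieldP X; have [lY dY] := vfieldP Y.
have addX f h : X (f + h) = X f + X h by rewrite -[f]scale1r lX !scale1r.
have addY f h : Y (f + h) = Y f + Y h by rewrite -[f]scale1r lY !scale1r.
apply/asboolP; split=> [a f h|f h].
  by rewrite lX lY lX lY scalerBr addrACA opprD.
rewrite dX dY addX addY !dX !dY.
ring.
Qed.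

Definition lie_bracket X Y : vfield M := MkVfield (lie_derivation X Y).

End VectorFieldStructure.

Section Forms.
Context {R : realType} {n : nat}.
Implicit Type M : smoothManifold R n.

Definition oneForm_pred M : {pred vfield M -> Cinf M} :=
  [pred w | `[< scalar w >]].

Record oneForm M := MkOneForm {
  oneForm_fun :> vfield M -> Cinf M; _ : oneForm_fun \in @oneForm_pred M }.

Lemma oneForm_zmod M : zmod_closed (@oneForm_pred M).
Proof.
split=> [|v w /asboolP lv /asboolP lw]; apply/asboolP => f X Y.
- by rewrite /= mulr0 addr0.
- by rewrite !fctE lv lw mulrBr addrACA opprD.
Qed.

End Forms.

Section FormStructure.
Context (R : realType) (n : nat) (M : smoothManifold R n).
Implicit Types (f h : Cinf M) (X Y : vfield M) (w : oneForm M).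

HB.instance Definition _ := [isSub for @oneForm_fun R n M].
HB.instance Definition _ := [Choice of oneForm M by <:].
HB.instance Definition _ :=
  GRing.SubChoice_isSubZmodule.Build (vfield M -> Cinf M)
    (@oneForm_pred R n M) (oneForm M) (oneForm_zmod M).

Lemma oneFormP w : scalar w.
Proof. by case: w => w /= /asboolP. Qed.

Lemma oneForm_ext (v w : oneForm M) : (forall X, v X = w X) -> v = w.
Proof. by move=> vw; apply/val_inj/funext. Qed.

Lemma scale_scalar h w : (fun X => h * w X) \in @oneForm_pred R n M.
Proof.
apply/asboolP => f X Y; rewrite oneFormP mulrDr; congr (_ + _).
exact: mulrCA.
Qed.

Definition scale_oneForm h w : oneForm M := MkOneForm (scale_scalar h w).

Fact scale_oneFormA f h w : scale_oneForm f (scale_oneForm h w) = scale_oneForm (f * h) w.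
Proof. by apply: oneForm_ext => X; rewrite /= mulrA. Qed.

Fact scale_oneForm1 : left_id 1 scale_oneForm.
Proof. by move=> w; apply: oneForm_ext => X; rewrite /= mul1r. Qed.

Fact scale_oneFormDr : right_distributive scale_oneForm +%R.
Proof. by move=> h v w; apply: oneForm_ext => X; rewrite /= mulrDr. Qed.

Fact scale_oneFormDl w : {morph scale_oneForm^~ w : f h / f + h}.
Proof. by move=> f h; apply: oneForm_ext => X; rewrite /= mulrDl. Qed.

HB.instance Definition _ := GRing.Zmodule_isLmodule.Build (Cinf M) (oneForm M)
  scale_oneFormA scale_oneForm1 scale_oneFormDr scale_oneFormDl.

Lemma oneForm_linear_comp (J : {linear vfield M -> vfield M}) w :
  (fun X => w (J X)) \in @oneForm_pred R n M.
Proof. by apply/asboolP => f X Y; rewrite linearP oneFormP. Qed.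

(* The transpose [J^*] of an endomorphism [J] of the tangent bundle. *)
Definition dual_endo (J : {linear vfield M -> vfield M}) w : oneForm M :=
  MkOneForm (oneForm_linear_comp J w).

End FormStructure.

Section RiemannianGeometry.
Context {R : realType} {n : nat}.
Implicit Type M : smoothManifold R n.

Record riemMetric M := RiemMetric {
  metric_fun :> vfield M -> vfield M -> Cinf M;
  metric_scalar : forall X, scalar (metric_fun X);
  metric_sym : forall X Y, metric_fun X Y = metric_fun Y X;
  metric_pos : forall (X : vfield M) (x : M),
    ~ (forall f, X f x = 0) -> 0 < metric_fun X X x }.

Record affineConnection M := Connection {
  connection_fun :> vfield M -> vfield M -> vfield M;
  connection_linearl : forall Y, linear (connection_fun ^~ Y);
  connection_addr : forall X, {morph connection_fun X : Y Z / Y + Z};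
  connection_leibniz : forall (X : vfield M) f Y,
    connection_fun X (f *: Y) = X f *: Y + f *: connection_fun X Y }.

Definition levi_civita M (g : riemMetric M) (nabla : affineConnection M) : Prop :=
  (forall X Y, nabla X Y - nabla Y X = lie_bracket X Y) /\
  (forall X Y Z : vfield M, X (g Y Z) = g (nabla X Y) Z + g Y (nabla X Z)).

Definition cst_Cinf M (a : R) : Cinf M := a *: (1 : Cinf M).

Definition metallic_riemannian M (p q : R)
    (J : {linear vfield M -> vfield M}) (g : riemMetric M) : Prop :=
  (forall X, J (J X) = cst_Cinf M p *: J X + cst_Cinf M q *: X) /\
  (forall X Y, g (J X) Y = g X (J Y)).

Definition parallel_endo M (nabla : affineConnection M)
    (J : {linear vfield M -> vfield M}) : Prop :=
  forall X Y, nabla X (J Y) = J (nabla X Y).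

Definition locally_metallic M (p q : R) (J : {linear vfield M -> vfield M})
    (g : riemMetric M) (nabla : affineConnection M) : Prop :=
  metallic_riemannian p q J g /\ parallel_endo nabla J.

End RiemannianGeometry.

Section Musical.
Context {R : realType} {n : nat} {M : smoothManifold R n} (g : riemMetric M).

Lemma flat_scalar X : (g X : vfield M -> Cinf M) \in @oneForm_pred R n M.
Proof. exact/asboolP/metric_scalar. Qed.

Definition flat_g X : oneForm M := MkOneForm (flat_scalar X).

Fact flat_linear : linear flat_g.
Proof.
move=> f X Y; apply: oneForm_ext => Z.
by rewrite /= [LHS]metric_sym metric_scalar ![g Z _]metric_sym.
Qed.

HB.instance Definition _ :=
  GRing.isLinear.Build (Cinf M) (vfield M) (oneForm M) *:%R flat_g flat_linear.

(* [sharp] is the two-sided inverse of [flat_g], hence unique, and automatically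
   [Cinf M]-linear. *)
Definition musical_inverse (sharp : {linear oneForm M -> vfield M}) : Prop :=
  cancel flat_g sharp /\ cancel sharp flat_g.

End Musical.

Section GeneralizedTangentBundle.
Context {R : realType} {n : nat} {M : smoothManifold R n}.

(* The dual connection on 1-forms. *)
Lemma conn_oneForm_scalar (nabla : affineConnection M) (X : vfield M) (w : oneForm M) :
  (fun Y => X (w Y) - w (nabla X Y)) \in @oneForm_pred R n M.
Proof.
have [lX dX] := vfieldP X.
have addX f h : X (f + h) = X f + X h by rewrite -[f]scale1r lX !scale1r.
have addw Y Z : w (Y + Z) = w Y + w Z.
  by rewrite -[Y]scale1r oneFormP mul1r scale1r.
have w0 : w 0 = 0 by apply: (addrI (w 0)); rewrite -addw !addr0.
have scalew f Y : w (f *: Y) = f * w Y by rewrite -[f *: Y]addr0 oneFormP w0 addr0.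
apply/asboolP => f Y Z.
rewrite connection_addr connection_leibniz !addw !scalew addX dX.
ring.
Qed.

Definition conn_oneForm (nabla : affineConnection M) (X : vfield M) (w : oneForm M) :
  oneForm M := MkOneForm (conn_oneForm_scalar nabla X w).

(* Sections of the direct sum of the tangent and cotangent bundles. *)
Definition gsection := (vfield M * oneForm M)%type.
HB.instance Definition _ := GRing.Lmodule.on gsection.

Definition gbracket (nabla : affineConnection M) (s t : gsection) : gsection :=
  (lie_bracket s.1 t.1, conn_oneForm nabla s.1 t.2 - conn_oneForm nabla t.1 s.2).

Definition nijenhuis (nabla : affineConnection M)
    (Jh : {linear gsection -> gsection}) (s t : gsection) : gsection :=
  gbracket nabla (Jh s) (Jh t) - Jh (gbracket nabla (Jh s) t)
  - Jh (gbracket nabla s (Jh t)) + Jh (Jh (gbracket nabla s t)).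

Definition nabla_integrable (nabla : affineConnection M)
    (Jh : {linear gsection -> gsection}) : Prop :=
  forall s t, nijenhuis nabla Jh s t = 0.

Definition generalized_complex (Jh : {linear gsection -> gsection}) : Prop :=
  forall s, Jh (Jh s) = - s.

Definition Jc (J : {linear vfield M -> vfield M}) (g : riemMetric M)
    (sharp : {linear oneForm M -> vfield M}) (s : gsection) : gsection :=
  (J s.1 - (sharp s.2 + J (J (sharp s.2))), flat_g g s.1 - dual_endo J s.2).

Fact Jc_linear J g sharp : linear (Jc J g sharp).
Proof.
have subst_add (V : zmodType) (a b c d : V) : a - b + (c - d) = a + c - (b + d).
  by rewrite opprD addrACA.
move=> f [X v] [Y w].
have trl : dual_endo J (f *: v + w) = f *: dual_endo J v + dual_endo J w.
  exact: oneForm_ext.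
change (Jc J g sharp (f *: X + Y, f *: v + w) =
  f *: Jc J g sharp (X, v) + Jc J g sharp (Y, w)).
have scale_pair a u : f *: ((a, u) : gsection) = (f *: a, f *: u) by [].
rewrite /Jc scale_pair /= trl; congr (_, _).
  rewrite !linearP scalerBr subst_add; congr (_ - _).
  by rewrite scalerDr addrACA.
rewrite [LHS](_ : _ = f *: flat_g g X + flat_g g Y - (f *: dual_endo J v + dual_endo J w)); last first.
  by rewrite -flat_linear.
by rewrite -subst_add -scalerBr.
Qed.

HB.instance Definition _ J g sharp :=
  GRing.isLinear.Build (Cinf M) gsection gsection *:%R (Jc J g sharp)
    (Jc_linear J g sharp).

(* The metallic identity itself is not needed. *)
Lemma generalized_complex_Jc (J : {linear vfield M -> vfield M}) (g : riemMetric M)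
    (sharp : {linear oneForm M -> vfield M}) :
  (forall X Y, g (J X) Y = g X (J Y)) -> musical_inverse g sharp ->
  generalized_complex (Jc J g sharp).
Proof.
move=> gJ [fK sK] [X w]; rewrite /Jc /=.
have trJ v : sharp (dual_endo J v) = J (sharp v).
  apply: (can_inj fK); rewrite sK; apply: oneForm_ext => Y /=.
  by rewrite gJ -[in LHS](sK v).
have trB u v : dual_endo J (u - v) = dual_endo J u - dual_endo J v.
  exact: oneForm_ext.
have flJ Y : flat_g g (J Y) = dual_endo J (flat_g g Y)
  by apply: oneForm_ext => Z; exact: gJ.
change ((J (J X - (sharp w + J (J (sharp w)))) -
    (sharp (flat_g g X - dual_endo J w) +
       J (J (sharp (flat_g g X - dual_endo J w)))),
  flat_g g (J X - (sharp w + J (J (sharp w)))) -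
    dual_endo J (flat_g g X - dual_endo J w)) = (- X, - w) :> gsection).
congr (_, _).
- have cancel_sum (a b c : vfield M) : a - (b + c) - (X - b + (a - c)) = - X.
    by rewrite [X - b + _]addrACA -opprD -addrA [- (X + _)]opprD addrCA subrr addr0.
  by rewrite (linearB sharp) fK trJ !(linearB J) (linearD J) /= cancel_sum.
- have cancel_sum (a b c : oneForm M) : a - (b + c) - (a - c) = - b.
    have -> : a - (b + c) = - b + (a - c) by rewrite opprD addrCA.
    exact: addrK.
  by rewrite (linearB (flat_g g)) (linearD (flat_g g)) /= !flJ sK trB cancel_sum.
Qed.

End GeneralizedTangentBundle.

(* Main.v *)
Require Import Defs.
From mathcomp Require Import all_boot all_order all_algebra.
From mathcomp Require Import all_classical all_reals all_analysis.

(** The Levi-Civita connection acts on sections of the generalized tangent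
    bundle componentwise: covariant differentiation on the tangent part, the
    dual connection on the cotangent part ([gconn]). Two facts carry the proof.

    Since the connection has no torsion, the bracket of [s] and [t] is the
    antisymmetrized derivative D_s t - D_t s, where D_s differentiates along the
    tangent part of [s] ([gbracket_gconn]). When an endomorphism commutes with
    every D_Z, each copy of it that acts on the section being differentiated can
    be moved outside the derivative, and the eight terms of the Nijenhuis tensor
    cancel in pairs ([parallel_nabla_integrable]). Thus any parallel endomorphism
    of the generalized tangent bundle is integrable.

    The endomorphism [Jc] is parallel because it is assembled from parallel
    pieces ([gconn_Jc]): [J] by hypothesis, hence also its transpose, and the
    musical isomorphisms because the metric is parallel. *)

Set Implicit Arguments.
Unset Strict Implicit.
Unset Printing Implicit Defensive.

Import GRing.Theory.
Local Open Scope ring_scope.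

Section ParallelEndomorphisms.
Context {R : realType} {n : nat} {M : smoothManifold R n}.
Variable nabla : affineConnection M.
Implicit Types (X Y Z : vfield M) (v w : oneForm M) (s t : @gsection R n M).

Lemma connectionB Z X Y : nabla Z (X - Y) = nabla Z X - nabla Z Y.
Proof. by rewrite -{2}(subrK Y X) [in RHS]connection_addr addrK. Qed.

Lemma vfieldB X : {morph X : f h / f - h}.
Proof.
have [lX _] := vfieldP X.
have addX f h : X (f + h) = X f + X h by rewrite -[f]scale1r lX !scale1r.
by move=> f h; apply: (addIr (X h)); rewrite -addX !subrK.
Qed.

Lemma conn_oneFormB Z v w :
  conn_oneForm nabla Z (v - w) = conn_oneForm nabla Z v - conn_oneForm nabla Z w.
Proof.
apply: oneForm_ext => Y.
change (Z (v Y - w Y) - (v (nabla Z Y) - w (nabla Z Y)) =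
  Z (v Y) - v (nabla Z Y) - (Z (w Y) - w (nabla Z Y))).
by rewrite vfieldB !opprD !opprK addrACA.
Qed.

Definition gconn Z s : @gsection R n M :=
  (nabla Z s.1, conn_oneForm nabla Z s.2).

Lemma gbracket_gconn s t :
  (forall X Y, nabla X Y - nabla Y X = lie_bracket X Y) ->
  gbracket nabla s t = gconn s.1 t - gconn t.1 s.
Proof. by move=> torsion_free; rewrite /gbracket -torsion_free. Qed.

(** With the bracket written as an antisymmetrized derivative, commuting [Jh]
    past [gconn] turns each of the eight terms of the Nijenhuis tensor into the
    opposite of another one: the derivatives along [Jh s] and [Jh t] of the
    first bracket cancel those of the two middle brackets, and what is left of
    the middle brackets cancels the last one. *)
Lemma parallel_nabla_integrable (Jh : {linear @gsection R n M -> @gsection R n M}) :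
  (forall X Y, nabla X Y - nabla Y X = lie_bracket X Y) ->
  (forall Z s, gconn Z (Jh s) = Jh (gconn Z s)) ->
  nabla_integrable nabla Jh.
Proof.
move=> torsion_free Jh_par s t; rewrite /nijenhuis !gbracket_gconn //.
rewrite !(linearB Jh) /= !Jh_par.
set a := Jh (gconn (Jh s).1 t); set b := Jh (gconn (Jh t).1 s).
set c := Jh (Jh (gconn s.1 t)); set d := Jh (Jh (gconn t.1 s)).
have cancel_terms (V : zmodType) (x y z u : V) :
    x - y - (x - u) - (z - y) + (z - u) = 0.
  have -> : x - y - (x - u) = u - y by rewrite opprB addrC addrA subrK.
  have -> : u - y - (z - y) = u - z by rewrite opprB addrA subrK.
  by rewrite addrA subrK subrr.
exact: cancel_terms.
Qed.

Lemma conn_dual_endo (J : {linear vfield M -> vfield M}) Z w :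
  parallel_endo nabla J ->
  conn_oneForm nabla Z (dual_endo J w) = dual_endo J (conn_oneForm nabla Z w).
Proof. by move=> J_par; apply: oneForm_ext => Y /=; rewrite J_par. Qed.

(** This is metric compatibility read as the flat isomorphism being parallel:
    the Leibniz rule for [g X Y] isolates the term [g (nabla Z X) Y]. *)
Lemma conn_flat (g : riemMetric M) Z X :
  (forall X Y Z, X (g Y Z) = g (nabla X Y) Z + g Y (nabla X Z)) ->
  conn_oneForm nabla Z (flat_g g X) = flat_g g (nabla Z X).
Proof. by move=> g_par; apply: oneForm_ext => Y /=; rewrite g_par addrK. Qed.

Lemma conn_sharp (g : riemMetric M) (sharp : {linear oneForm M -> vfield M}) Z w :
  (forall X Y Z, X (g Y Z) = g (nabla X Y) Z + g Y (nabla X Z)) ->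
  musical_inverse g sharp ->
  nabla Z (sharp w) = sharp (conn_oneForm nabla Z w).
Proof.
by move=> g_par [fK sK]; apply: (can_inj fK); rewrite -conn_flat // !sK.
Qed.

Lemma gconn_Jc (J : {linear vfield M -> vfield M}) (g : riemMetric M)
    (sharp : {linear oneForm M -> vfield M}) Z s :
  (forall X Y Z, X (g Y Z) = g (nabla X Y) Z + g Y (nabla X Z)) ->
  parallel_endo nabla J -> musical_inverse g sharp ->
  gconn Z (Jc J g sharp s) = Jc J g sharp (gconn Z s).
Proof.
move=> g_par J_par sharpK; rewrite /gconn /Jc /=; congr (_, _).
  by rewrite connectionB connection_addr !J_par (conn_sharp _ _ g_par sharpK).
by rewrite conn_oneFormB conn_flat // conn_dual_endo.
Qed.

End ParallelEndomorphisms.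

Theorem proposition2p18 (R : realType) (n : nat) (M : smoothManifold R n)
    (p q : R) (J : {linear vfield M -> vfield M}) (g : riemMetric M)
    (nabla : affineConnection M) (sharp : {linear oneForm M -> vfield M})
    (hnabla : levi_civita g nabla) (hJ : locally_metallic p q J g nabla)
    (hsharp : musical_inverse g sharp) :
  nabla_integrable nabla (Jc J g sharp).
Proof.
have [torsion_free g_par] := hnabla; have [_ J_par] := hJ.
by apply: parallel_nabla_integrable => // Z s; exact: gconn_Jc.
Qed.
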